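(* Consider the interval game in which both the single enemy $\varphi$ and $\psi$ are rigid rotations of $S^1=\mathbb{R}/\mathbb{Z}$, through $u$ and $t$ respectively. Then there is a winning interval if and only if $(t,u)$ is contained in an explicit open subset $U$ of the unit square, described recursively as follows. Winning pairs $(t,u)$ are classified by which iterate $n$ of $\psi$ certifies the win, and the smallest integer $m$ such that $nt<m$; let $U(m)$ be the subset of $U$ with a given value of $m$. Then $U(1)$ is the union over all $n\ge 2$ and $1\le i\le n-1$ of the interiors of the triangles with vertices $$\left(\tfrac1n,\tfrac in\right),\quad \left(\tfrac1{n-1},\tfrac{i-1}{n-1}\right),\quad \left(\tfrac1{n-1},\tfrac{i}{n-1}\right).$$ Moreover, if $\left(\tfrac tm,\tfrac{u+i}{m}\right)\in U$ for all integers $0\le i<m$ then $(t,u)\in U$, and any element of $U(m)$ is of this kind.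
   Context: Interval game: the data are finitely many orientation-preserving homeomorphisms $\varphi_1,\dots,\varphi_k$ of $S^1$ (the enemies; here there is just one, $\varphi$) and an orientation-preserving homeomorphism $\psi$ of $S^1$. An interval $I\subset S^1$ wins (is a winning interval) if there is some positive integer $n$ so that $\psi^i(I)$ is disjoint from $\varphi_j(I)$ for all $j$ and for $0\le i\le n$, and if $\psi^n(I^+)$ is contained in the interior of $I$, where $I^+$ denotes the rightmost point of $I$; such an $n$ is said to certify the win. The rigid rotation through $\theta$ is the map $z\mapsto z+\theta$ of $S^1$.
   Formalization: A win requires only that ψ^i(I^+), not all of ψ^i(I), avoid φ(I) (otherwise t=3/5, u=1/2 in U(1) fails); and the points (t/m,(u+i)/m) must all lie in one common piece U(k), not merely in U (otherwise t=14/25, u=2/25, m=3 fails). *)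

(* Defs.v *)
From HB Require Import structures.
From mathcomp Require Import all_boot all_order all_algebra generic_quotient.
From mathcomp Require Import ring_quotient archimedean.
From mathcomp Require Import all_classical all_reals all_analysis.

Set Implicit Arguments.
Unset Strict Implicit.
Unset Printing Implicit Defensive.

Import Order.TTheory GRing.Theory Num.Theory.
Import numFieldNormedType.Exports.

Local Open Scope classical_set_scope.
Local Open Scope ring_scope.
Local Open Scope quotient_scope.

Definition real_mod_int (R : realType) : quotType R :=
  Quotient.quot (GRing.ZmodClosed.clone R (@Num.int_num_subdef R) _).

Definition circle (R : realType) : Type := quotient_topology (real_mod_int R).

HB.instance Definition _ (R : realType) := Topological.on (circle R).
HB.instance Definition _ (R : realType) :=
  GRing.Zmodule.copy (circle R) (real_mod_int R).

Definition circle_pi (R : realType) (x : R) : circle R :=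
  \pi_(real_mod_int R) x.

Lemma circle_piD (R : realType) :
  {morph @circle_pi R : x y / x + y >-> x + y}.
Proof. exact: (@pi_addr _ _ _ _ _ (real_mod_int R)). Qed.

Lemma circle_pi_surj (R : realType) (z : circle R) : exists x, circle_pi x = z.
Proof. by exists (repr (z : real_mod_int R)); rewrite /circle_pi reprK. Qed.

Lemma circle_continuous (R : realType) (f : circle R -> circle R) :
  continuous (f \o @circle_pi R) -> continuous f.
Proof.
exact: (@quotient_continuous R (real_mod_int R) (circle R) f).2.
Qed.

Lemma circle_pi_continuous (R : realType) : continuous (@circle_pi R).
Proof. exact: (@pi_continuous R (real_mod_int R)). Qed.

(* A homeomorphism of the circle preserves orientation when it lifts to an
   increasing map of the line. *)
Record oriented_homeo (R : realType) := OrientedHomeo {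
  homeo_fun :> circle R -> circle R;
  homeo_continuous : continuous homeo_fun;
  homeo_inverse : exists g : circle R -> circle R,
    [/\ continuous g, cancel homeo_fun g & cancel g homeo_fun];
  homeo_oriented : exists F : R -> R,
    [/\ continuous F, {homo F : x y / x < y} &
        forall x, homeo_fun (circle_pi x) = circle_pi (F x)]
}.

Lemma circle_translate_continuous (R : realType) (a : R) :
  continuous (fun z : circle R => z + circle_pi a).
Proof.
apply: circle_continuous.
rewrite (_ : _ \o _ = @circle_pi R \o (fun x : R => x + a)); last first.
  by apply/funext => x /=; rewrite circle_piD.
move=> x; apply: continuous_comp; last exact: circle_pi_continuous.
by apply: cvgD; [exact: cvg_id | exact: cvg_cst].
Qed.

Definition rotation (R : realType) (a : R) : oriented_homeo R.
Proof.
refine (@OrientedHomeo R (fun z => z + circle_pi a) _ _ _).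
- exact: circle_translate_continuous.
- exists (fun z => z + circle_pi (- a)); split.
  + exact: circle_translate_continuous.
  + move=> z /=; rewrite -addrA -circle_piD subrr.
    by have [x <-] := circle_pi_surj z; rewrite -circle_piD addr0.
  + move=> z /=; rewrite -addrA -circle_piD addNr.
    by have [x <-] := circle_pi_surj z; rewrite -circle_piD addr0.
- exists (fun x => x + a); split.
  + by move=> x; apply: cvgD; [exact: cvg_id | exact: cvg_cst].
  + by move=> x y xy; rewrite ltrD2r.
  + by move=> x; rewrite circle_piD.
Defined.

(* The closed arc of the circle running in the positive direction from
   [arc_lo] to [arc_hi]. *)
Record arc (R : realType) := Arc {
  arc_lo : R;
  arc_hi : R;
  arc_proper : arc_lo < arc_hi < arc_lo + 1
}.

Definition arc_set (R : realType) (I : arc R) : set (circle R) :=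
  @circle_pi R @` [set` `[arc_lo I, arc_hi I]%R].

Definition arc_right (R : realType) (I : arc R) : circle R :=
  circle_pi (arc_hi I).

(* Only the forward orbit of the rightmost point, not the orbit of the whole
   arc, has to avoid the sets [phi j I].  With the stronger condition that
   [psi^i I] be disjoint from [phi j I], the winning pairs of rotations would
   not be described by the triangles of [U1]: no arc would win for t = 3/5,
   u = 1/2, a point interior to the triangle with n = 2 and i = 1. *)
Definition certifies (R : realType) (k : nat) (phi : 'I_k -> oriented_homeo R)
    (psi : oriented_homeo R) (I : arc R) (n : nat) : Prop :=
  [/\ (0 < n)%N,
      forall (j : 'I_k) (i : nat), (i <= n)%N ->
        ~ (phi j @` arc_set I) (iter i psi (arc_right I)) &
      (arc_set I)^° (iter n psi (arc_right I))].

Definition wins (R : realType) (k : nat) (phi : 'I_k -> oriented_homeo R)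
    (psi : oriented_homeo R) (I : arc R) : Prop :=
  exists n, certifies phi psi I n.

Definition triangle (R : realType) (A B C : R * R) : set (R * R) :=
  [set p | exists a b c : R,
     [/\ 0 <= a, 0 <= b, 0 <= c & a + b + c = 1] /\
     p = (a * A.1 + b * B.1 + c * C.1, a * A.2 + b * B.2 + c * C.2)].

Definition U1 (R : realType) : set (R * R) :=
  \bigcup_(n in [set n | (2 <= n)%N])
  \bigcup_(i in [set i | (1 <= i <= n - 1)%N])
    (triangle (1 / n%:R, i%:R / n%:R)
              (1 / (n - 1)%:R, (i - 1)%:R / (n - 1)%:R)
              (1 / (n - 1)%:R, i%:R / (n - 1)%:R))^°.

Definition unit_square (R : realType) : set (R * R) :=
  [set p | 0 <= p.1 <= 1 /\ 0 <= p.2 <= 1].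

Definition U (R : realType) : set (R * R) :=
  @unit_square R `&`
  [set p | exists m : nat, (0 < m)%N /\
     forall i : nat, (i < m)%N -> U1 (p.1 / m%:R, (p.2 + i%:R) / m%:R)].

Definition U_piece (R : realType) (m : nat) : set (R * R) :=
  @U R `&`
  [set p | exists n : nat,
     [/\ exists I, certifies (fun _ : 'I_1 => rotation p.2) (rotation p.1) I n,
         n%:R * p.1 < m%:R &
         forall m' : int, n%:R * p.1 < m'%:~R -> m%:Z <= m']].

(* The points (t / m, (u + i) / m) are asked to lie in one common piece of U.
   If the piece could vary with i, [subdivided m t u] would not imply that
   (t, u) is in U: for t = 14/25, u = 2/25 and m = 3 the three points lie in
   U, the first only in U_piece 3 and the last only in U_piece 1, but (t, u)
   is not in U. *)
Definition subdivided (R : realType) (m : nat) (t u : R) : Prop :=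
  exists k : nat, forall i : nat, (i < m)%N ->
    U_piece k (t / m%:R, (u + i%:R) / m%:R).

(* Main.v *)
(* Lift to the line.  An arc of length [L < 1] is certified by [n] exactly when
   [m - n t < L], with [m] the least integer above [n t], and no translate
   [u + j] meets [[i t, i t + L]] for [0 <= i <= n].  Only finitely many closed
   conditions are involved, so [L] can be taken slightly larger than [m - n t]:
   a win means that [u, u + 1, ..., u + m - 1] lie in the gaps left in [[0, m]]
   by the arcs [[i t, i t + (m - n t)]].  For [m = 1] the gaps are the vertical
   sections of the triangles, and since the condition is homogeneous, dividing
   by [m] reduces the general case to [m = 1].  The index [n] is determined by
   [m / (n + 1) < t < m / n], hence is common to all the rescaled points. *)
Require Import Defs.
From mathcomp Require Import all_boot all_order all_algebra.
From mathcomp Require Import generic_quotient ring_quotient lra ring zify.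
From mathcomp Require Import all_classical all_reals all_analysis.

Set Implicit Arguments.
Unset Strict Implicit.
Unset Printing Implicit Defensive.

Import Order.TTheory GRing.Theory Num.Theory.
Import numFieldNormedType.Exports.

Local Open Scope classical_set_scope.
Local Open Scope ring_scope.

(** * Arcs of the circle, lifted to the line *)

Lemma circle_pi_eqP (R : realType) (x y : R) :
  circle_pi x = circle_pi y <-> exists k : int, x = y + k%:~R.
Proof.
have pi_eq := Quotient.idealrBE (GRing.ZmodClosed.clone R (@Num.int_num_subdef R) _) x y.
split=> [xy|[k xE]].
  have /intrP[k xyk] : x - y \is a Num.int by apply: etrans pi_eq _; apply/eqP.
  by exists k; rewrite -xyk addrC subrK.
have : x - y \is a Num.int by rewrite xE addrAC subrr add0r; exact: intr_int.
by move=> /(etrans (esym pi_eq)) /eqP.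
Qed.

Lemma arc_setP (R : realType) (I : Defs.arc R) (x : R) :
  arc_set I (circle_pi x) <->
  exists k : int, arc_lo I <= x + k%:~R <= arc_hi I.
Proof.
split=> [[y /= yI /circle_pi_eqP[k yE]]|[k xk]].
  by exists k; move: yI; rewrite in_itv /= yE.
exists (x + k%:~R); first by rewrite /= in_itv.
by apply/circle_pi_eqP; exists k.
Qed.

Lemma open_circle_arc (R : realType) (a b : R) :
  open (@circle_pi R @` `]a, b[).
Proof.
suff: open (@circle_pi R @^-1` (@circle_pi R @` `]a, b[)) by [].
rewrite (_ : _ @^-1` _ =
  \bigcup_(k in [set: int]) [set x | a - k%:~R < x < b - k%:~R]).
  apply: bigcup_open => k _.
  have -> : [set x : R | a - k%:~R < x < b - k%:~R] = 
    [set` `]a - k%:~R, b - k%:~R[] by apply/seteqP; split=> x /=; rewrite in_itv.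
  exact: interval_open.
apply/seteqP; split=> x /=.
  move=> [y]; rewrite /= in_itv /= => yab /circle_pi_eqP[k yE].
  by exists k => //=; lra.
move=> [k _ /= xk]; exists (x + k%:~R).
  by rewrite /= in_itv /=; lra.
by apply/circle_pi_eqP; exists k.
Qed.

Lemma int_eq_of_dist_lt1 (R : realType) (k l : int) :
  (k%:~R : R) < l%:~R + 1 -> (l%:~R : R) < k%:~R + 1 -> k = l.
Proof.
by rewrite -!(intrD R _ 1) !ltr_int => kl lk; lia.
Qed.

Lemma interior_arc_setP (R : realType) (I : Defs.arc R) (x : R) :
  (arc_set I)^° (circle_pi x) <->
  exists k : int, arc_lo I < x + k%:~R < arc_hi I.
Proof.
have /andP[lohi hilo] := arc_proper I; split; last first.
  move=> [k xk]; rewrite /interior /= nbhsE.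
  exists (@circle_pi R @` `]arc_lo I, arc_hi I[).
    split; first exact: open_circle_arc.
    exists (x + k%:~R); first by rewrite /= in_itv.
    by apply/circle_pi_eqP; exists k.
  apply: image_subset => y /=; rewrite !in_itv /= => /andP[? ?].
  by rewrite !ltW.
move=> /(@circle_pi_continuous R x); rewrite /nbhs /= => /nbhs_ballP[e /= e0 xe].
(* The second bound keeps [d] below the length of the complementary arc, so [x - d], [x] and [x + d]
   are brought into the lifted arc by the same integer. *)
pose d := Num.min (e / 2) ((arc_lo I + 1 - arc_hi I) / 2).
have d0 : 0 < d by rewrite lt_min; apply/andP; split; lra.
have [dle dlI] : d <= e / 2 /\ d <= (arc_lo I + 1 - arc_hi I) / 2.
  by rewrite /d !ge_min !lexx orbT.
have in_arc y : `|x - y| < e -> exists k : int, arc_lo I <= y + k%:~R <= arc_hi I.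
  by move=> xy; apply/arc_setP/xe.
have [|k0 k0I] := in_arc (x - d); first by rewrite ltr_norml; lra.
have [|k1 k1I] := in_arc (x + d); first by rewrite ltr_norml; lra.
have [|k2 k2I] := in_arc x; first by rewrite subrr normr0.
have k02 : k0 = k2 by apply: (@int_eq_of_dist_lt1 R); lra.
have k12 : k1 = k2 by apply: (@int_eq_of_dist_lt1 R); lra.
by exists k2; subst k0 k1; lra.
Qed.

(** * Orbits of rotations and gap conditions *)

Lemma iter_rotation (R : realType) (t x : R) (n : nat) :
  iter n (rotation t) (circle_pi x) = circle_pi (x + n%:R * t).
Proof.
elim: n => [|n IH]; first by rewrite mul0r addr0.
rewrite iterS IH /= -circle_piD; congr circle_pi; ring.
Qed.

Lemma certifies_rotationP (R : realType) (t u : R) (I : Defs.arc R) (n : nat) :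
  certifies (fun _ : 'I_1 => rotation u) (rotation t) I n <->
  [/\ (0 < n)%N,
      forall (i : nat) (k : int), (i <= n)%N ->
        ~ arc_lo I + u <= arc_hi I + i%:R * t + k%:~R <= arc_hi I + u &
      exists k : int, arc_lo I < arc_hi I + n%:R * t + k%:~R < arc_hi I].
Proof.
rewrite /certifies /arc_right !iter_rotation.
split=> -[n0 avoid land]; split=> //; try exact/interior_arc_setP.
  move=> i k le_in ik; apply: (avoid ord0 i le_in).
  exists (circle_pi (arc_hi I + i%:R * t - u)).
    by apply/arc_setP; exists k; lra.
  by rewrite iter_rotation /= -circle_piD subrK.
move=> _ i le_in [_ [y /= yI <-]].
rewrite iter_rotation -circle_piD => /circle_pi_eqP[k yE].
apply: (avoid i k le_in); rewrite -yE.
by move: yI; rewrite in_itv /=; lra.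
Qed.

(* The points [u + i], [0 <= i < m], of [[0, m]] must avoid the arcs
   [[l t, l t + (m - n t)]], [0 <= l <= n]; as the first arc starts at [0] and
   the last one ends at [m], each of them lies in a gap between the arcs of
   indices [l] and [l + 1]. *)
Definition gap_cert (R : realType) (n m : nat) (t u : R) : Prop :=
  [/\ (0 < m)%N, n%:R * t < m%:R &
      forall i, (i < m)%N -> exists2 l, (l < n)%N &
        l%:R * t + (m%:R - n%:R * t) < u + i%:R < l.+1%:R * t].

(** The gap containing [u] is nonempty, so its length [t - (m - n t)] is positive; the points with
    [i = 0] and [i = m - 1] then bound [u]. *)
Lemma gap_cert_bounds (R : realType) (n m : nat) (t u : R) :
  gap_cert n m t u ->
  [/\ (0 < n)%N, m%:R < n.+1%:R * t, 0 < t & 0 < u < 1].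
Proof.
move=> [m0 ntm gaps].
have [l ln ul] := gaps 0%N m0.
have [l' ln' ul'] : exists2 l, (l < n)%N &
    l%:R * t + (m%:R - n%:R * t) < u + m.-1%:R < l.+1%:R * t.
  by apply: gaps; rewrite prednK.
have n0 : (0 < n)%N by apply: leq_ltn_trans ln.
have mR : m%:R = m.-1%:R + 1 :> R by rewrite natr1 prednK.
have mlt : m%:R < n.+1%:R * t by move: ul; rewrite -!natr1; lra.
have t0 : 0 < t.
  by rewrite -(@pmulr_rgt0 _ n.+1%:R) ?ltr0Sn //; apply: le_lt_trans mlt; exact: ler0n.
split=> //; apply/andP; split.
  by have := mulr_ge0 (ler0n R l) (ltW t0); move: ul; lra.
have : l'.+1%:R * t <= n%:R * t by rewrite ler_pM2r // ler_nat.
by move: ul'; lra.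
Qed.

(** Both indices satisfy [m / (n + 1) < t < m / n], which involves only [m] and [t]. Hence
    certificates at different [u] can be combined. *)
Lemma gap_cert_inj (R : realType) (n n' m : nat) (t u u' : R) :
  gap_cert n m t u -> gap_cert n' m t u' -> n = n'.
Proof.
move=> c c'; have [_ mn t0 _] := gap_cert_bounds c.
have [_ mn' _ _] := gap_cert_bounds c'.
case: c c' => _ nm _ [_ n'm _].
have le_t (a b : nat) : a%:R * t < b.+1%:R * t -> (a <= b)%N.
  by rewrite ltr_pM2r // ltr_nat ltnS.
by apply/eqP; rewrite eqn_leq !le_t //; apply: lt_trans; eassumption.
Qed.

(** Multiplication by [m] sends [(u + i) / m + j] to [u + (j m + i)], and Euclidean division by [m]
    matches the indices below [k m] with the pairs [(j, i)]. *)
Lemma gap_cert_divP (R : realType) (n k m : nat) (t u : R) : (0 < m)%N ->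
  gap_cert n (k * m) t u <->
  forall i, (i < m)%N -> gap_cert n k (t / m%:R) ((u + i%:R) / m%:R).
Proof.
move=> m0; have mR0 : 0 < m%:R :> R by rewrite ltr0n.
have scale (c x y : R) : (c * (x / m%:R) < y) = (c * x < y * m%:R).
  by rewrite mulrA ltr_pdivrMr.
have gapE (j l i : nat) :
    (l%:R * (t / m%:R) + (k%:R - n%:R * (t / m%:R)) <
       (u + i%:R) / m%:R + j%:R < l.+1%:R * (t / m%:R)) =
    (l%:R * t + ((k * m)%:R - n%:R * t) < u + (j * m + i)%:R < l.+1%:R * t).
  rewrite -(ltr_pM2r mR0) -[in X in _ && X](ltr_pM2r mR0) natrM natrD natrM.
  by congr (_ && _); congr (_ < _); field; rewrite gt_eqF.
split=> [[km0 ntkm gaps] i im|c].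
  have k0 : (0 < k)%N by move: km0; rewrite muln_gt0 => /andP[].
  split=> //; first by rewrite scale -natrM.
  move=> j jk; have [|l ln ul] := gaps (j * m + i)%N; last by exists l; rewrite ?gapE.
  by apply: (@leq_trans (j.+1 * m)); rewrite ?leq_mul2r ?jk ?orbT// mulSn addnC ltn_add2r.
have [k0 ntk _] := c _ m0.
split; [by rewrite muln_gt0 k0|by move: ntk; rewrite scale -natrM|].
move=> i ikm; have [_ _ gaps] := c _ (ltn_pmod i m0).
have [|l ln ul] := gaps (i %/ m)%N; first by rewrite ltn_divLR.
by exists l => //; move: ul; rewrite gapE -divn_eq.
Qed.

(** * Triangles as gap conditions *)

(** Up to positive factors, the barycentric coordinates are the slacks of the three inequalities. *)
Lemma triangleP (R : realType) (n l : nat) (t u : R) : (0 < n)%N ->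
  triangle (1 / n.+1%:R, l.+1%:R / n.+1%:R) (1 / n%:R, l%:R / n%:R)
    (1 / n%:R, l.+1%:R / n%:R) (t, u) <->
  n%:R * t <= 1 /\ l%:R * t + (1 - n%:R * t) <= u <= l.+1%:R * t.
Proof.
move=> n0; have nR : 0 < n%:R :> R by rewrite ltr0n.
have nS : 0 < n%:R + 1 :> R by rewrite natr1 ltr0n.
rewrite /triangle /= -!natr1; split=> [[a [b [c [[a0 b0 c0 abc] [-> ->]]]]]|[tn ul]].
  have cE : c = 1 - a - b by rewrite -abc; ring.
  set t' := a * (1 / (n%:R + 1)) + _ + _.
  set u' := a * ((l%:R + 1) / _) + _ + _.
  have h1 : 0 <= 1 - n%:R * t'.
    rewrite (_ : _ - _ = a / (n%:R + 1)); first exact: divr_ge0 (ltW nS).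
    by rewrite /t' cE; field; rewrite !gt_eqF.
  have h2 : 0 <= (l%:R + 1) * t' - u'.
    rewrite (_ : _ - _ = b / n%:R); first exact: divr_ge0 (ltW nR).
    by rewrite /t' /u'; field; rewrite !gt_eqF.
  have h3 : 0 <= u' - l%:R * t' - (1 - n%:R * t').
    rewrite (_ : _ - _ = c / n%:R); first exact: divr_ge0 (ltW nR).
    by rewrite /t' /u' cE; field; rewrite !gt_eqF.
  clearbody t' u'; split; first lra.
  by apply/andP; split; lra.
exists ((n%:R + 1) * (1 - n%:R * t)), (n%:R * ((l%:R + 1) * t - u)),
  (n%:R * (u - l%:R * t - (1 - n%:R * t))).
split; first by split; [apply: mulr_ge0; lra..|ring].
by congr pair; field; rewrite !gt_eqF.
Qed.

Lemma interior_triangleP (R : realType) (n l : nat) (t u : R) : (0 < n)%N ->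
  (triangle (1 / n.+1%:R, l.+1%:R / n.+1%:R) (1 / n%:R, l%:R / n%:R)
    (1 / n%:R, l.+1%:R / n%:R))^° (t, u) <->
  n%:R * t < 1 /\ l%:R * t + (1 - n%:R * t) < u < l.+1%:R * t.
Proof.
move=> n0; have nR : 0 < n%:R :> R by rewrite ltr0n.
split=> [/nbhs_ballP[e /= e0 tri]|tu].
  have tri' x y : `|t - x| < e -> `|u - y| < e ->
      n%:R * x <= 1 /\ l%:R * x + (1 - n%:R * x) <= y <= l.+1%:R * x.
    by move=> tx uy; apply/(triangleP _ _ _ n0)/tri; split.
  (* Moving [t] to the right makes the first inequality strict; moving [u] down or up does the same
     for the other two. *)
  have [||tn _] := tri' (t + e / 2) u; rewrite ?ltr_norml; try lra.
  have [||_ ul] := tri' t (u - e / 2); rewrite ?ltr_norml; try lra.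
  have [||_ ur] := tri' t (u + e / 2); rewrite ?ltr_norml; try lra.
  have : 0 < n%:R * (e / 2) by apply: mulr_gt0; lra.
  by split; lra.
pose f1 (p : R * R) := n%:R * p.1.
pose f2 (p : R * R) := l%:R * p.1 + (1 - n%:R * p.1) - p.2.
pose f3 (p : R * R) := p.2 - l.+1%:R * p.1.
have c1 : continuous f1.
  by move=> p; apply: cvgM; [exact: cvg_cst|exact: cvg_fst].
have c2 : continuous f2.
  move=> p; apply: cvgB; last exact: cvg_snd.
  apply: cvgD; first by apply: cvgM; [exact: cvg_cst|exact: cvg_fst].
  apply: cvgB; first exact: cvg_cst.
  by apply: cvgM; [exact: cvg_cst|exact: cvg_fst].
have c3 : continuous f3.
  move=> p; apply: cvgB; first exact: cvg_snd.
  by apply: cvgM; [exact: cvg_cst|exact: cvg_fst].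
have lt_near (f : R * R -> R) (c : R) : continuous f -> f (t, u) < c ->
    \forall p \near (t, u), f p < c.
  move=> fc fp; apply: (fc (t, u) [set y | y < c]).
  by apply: open_nbhs_nbhs; split => //; exact: open_lt.
have n1 := lt_near f1 1 c1 tu.1.
have n2 : \forall p \near (t, u), f2 p < 0.
  by apply: lt_near => //; rewrite /f2 /=; lra.
have n3 : \forall p \near (t, u), f3 p < 0.
  by apply: lt_near => //; rewrite /f3 /=; lra.
rewrite /interior /=; apply: filterS3 n1 n2 n3 => -[x y]; rewrite /f1 /f2 /f3 /= => p1 p2 p3.
by apply/triangleP => //; split; lra.
Qed.

(** Indices shift by one: the triangle of indices [n.+1] and [l.+1] in [U1] is the gap after the arc
    [l] for [n] steps. *)
Lemma U1P (R : realType) (t u : R) :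
  U1 (t, u) <-> exists n, gap_cert n 1 t u.
Proof.
split=> [[n /= n2] [i /= /andP[i1 il]]|[n c]].
  have [n' nE] : exists n', n = n'.+2 by exists n.-2; lia.
  have [l iE] : exists l, i = l.+1 by exists i.-1; lia.
  subst n i; rewrite !subn1 /= => /interior_triangleP[//|nt ul].
  exists n'.+1; split=> // -[|//] _; exists l; first lia.
  by rewrite addr0.
have [n0 _ _ _] := gap_cert_bounds c; case: c => _ nt /(_ 0%N isT)[l ln ul].
exists n.+1 => //=; exists l.+1; first by rewrite /= subn1.
rewrite !subn1 /=; apply/interior_triangleP => //.
by rewrite addr0 in ul.
Qed.

(** * The set [U] and its openness *)

(** The divisor [m] in [U] becomes the integer of [gap_cert], by [gap_cert_divP] with [k = 1];
    [gap_cert_inj] makes [n] independent of [i]. *)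
Lemma U_gap_certP (R : realType) (t u : R) :
  U (t, u) <-> unit_square (t, u) /\ exists n m, gap_cert n m t u.
Proof.
split=> [[sq [m /= [m0 U1m]]]|[sq [n [m c]]]]; split=> //.
  have /U1P[n c0] := U1m 0%N m0.
  exists n, m; rewrite -(mul1n m); apply/gap_cert_divP => // i im.
  have /U1P[n' ci] := U1m i im.
  by rewrite (gap_cert_inj c0 ci).
have m0 : (0 < m)%N by case: c.
exists m; split=> // i im /=; apply/U1P; exists n.
by move: i im; apply/gap_cert_divP => //; rewrite mul1n.
Qed.

(** The square is closed, so points of [U] must first be shown to lie in its interior. The other
    condition is a finite intersection of preimages of the open set [U1]. *)
Lemma open_U (R : realType) : open (@U R).
Proof.
suff nbhs_U (t u : R) : U (t, u) -> nbhs (t, u) (@U R).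
  by rewrite openE => -[t u]; exact: nbhs_U.
move=> Utu.
have /U_gap_certP[[/= t01 u01] [n [m c]]] := Utu.
have [n0 mnt t0 /andP[u0 u1]] := gap_cert_bounds c.
have t1 : t < 1.
  rewrite lt_neqAle; apply/andP; split; last by case/andP: t01.
  (* For [t = 1] the integer [m] would lie strictly between [n] and [n + 1]. *)
  apply/eqP => t1; case: c => _; rewrite t1 !mulr1 in mnt *.
  by move: mnt; rewrite !ltr_nat ltnS => mn; rewrite ltnNge mn.
have near01 (x : R) : 0 < x < 1 -> nbhs x [set y | 0 <= y <= 1].
  move=> x01; have : nbhs x [set` `]0, 1[%R] by apply: near_in_itvoo; rewrite in_itv.
  by apply: filterS => y /=; rewrite in_itv /= => /andP[? ?]; rewrite !ltW.
have sq_near : \forall p \near (t, u), unit_square p.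
  exists ([set y | 0 <= y <= 1], [set y | 0 <= y <= 1]) => //=.
  by split; apply: near01; rewrite ?t0 ?u0.
have oU1 : open (@U1 R).
  by apply: bigcup_open => k _; apply: bigcup_open => i _; exact: open_interior.
case: Utu => _ [m' /= [m'0 U1m']].
have U1_near : \forall p \near (t, u),
    forall i : 'I_m', U1 (p.1 / m'%:R, (p.2 + i%:R) / m'%:R).
  apply: (@filter_forall _ _ (fun (i : 'I_m') (p : R * R) =>
    U1 (p.1 / m'%:R, (p.2 + i%:R) / m'%:R)) _ (nbhs_filter (t, u))) => i.
  have sub_cont : {for (t, u), continuous
      (fun p : R * R => (p.1 / m'%:R, (p.2 + i%:R) / m'%:R))}.
    have c1 : (fun p : R * R => p.1 / m'%:R) @ (t, u) --> t / m'%:R.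
      by apply: cvgM; [exact: cvg_fst|exact: cvg_cst].
    have c2 : (fun p : R * R => (p.2 + i%:R) / m'%:R) @ (t, u) -->
        (u + i%:R) / m'%:R.
      apply: cvgM; last exact: cvg_cst.
      by apply: cvgD; [exact: cvg_snd|exact: cvg_cst].
    exact: (cvg_pair c1 c2).
  apply: sub_cont; apply: open_nbhs_nbhs; split=> //.
  exact: U1m'.
apply: filterS2 sq_near U1_near => p sq U1p; split=> //.
by exists m'; split=> // i im'; exact: (U1p (Ordinal im')).
Qed.

(** * Gap conditions and winning arcs *)

(** As [t <= 1], the bound [m < (n + 1) t] gives [m - 1 < n t]. *)
Lemma gap_cert_least (R : realType) (n m : nat) (t u : R) :
  unit_square (t, u) -> gap_cert n m t u -> (m%:R - 1 < n%:R * t) /\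
  forall m' : int, n%:R * t < m'%:~R -> m%:Z <= m'.
Proof.
move=> [/= /andP[_ t1] _] c; have [_ mnt _ _] := gap_cert_bounds c.
have mlt : m%:R - 1 < n%:R * t by move: mnt; rewrite -natr1; lra.
split=> // m' ntm'; have : (m%:Z%:~R : R) < m'%:~R + 1 by lra.
by rewrite -(intrD R _ 1) ltr_int; lia.
Qed.

Lemma certifies_gap_cert (R : realType) (t u : R) (I : Defs.arc R) (n m : nat) :
  unit_square (t, u) ->
  certifies (fun _ : 'I_1 => rotation u) (rotation t) I n ->
  n%:R * t < m%:R -> (forall m' : int, n%:R * t < m'%:~R -> m%:Z <= m') ->
  gap_cert n m t u.
Proof.
move=> [/= /andP[t0 t1] /andP[u0 u1]] /certifies_rotationP[n0 avoid [k land]].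
move=> ntm mmin; have /andP[lohi hilo] := arc_proper I.
have nt0 : 0 <= n%:R * t by apply: mulr_ge0.
have m0 : (0 < m)%N by rewrite -(ltr_nat R); apply: le_lt_trans ntm.
(* Landing makes [- k] an integer above [n t], so minimality of [m] applies. *)
have mk : (m%:R : R) <= - k%:~R.
  by rewrite -mulrNz -[m%:R]/(m%:Z%:~R) ler_int mmin // mulrNz; lra.
have mL : m%:R - n%:R * t < arc_hi I - arc_lo I by lra.
split=> // i im; have iR : (i%:R : R) <= m%:R - 1.
  by rewrite lerBrDr natr1 ler_nat.
have gap (j : nat) : (j <= n)%N -> ~ (j%:R * t <= u + i%:R <=
    j%:R * t + (arc_hi I - arc_lo I)).
  by move=> jn ju; apply: (avoid j (- i%:Z) jn); rewrite mulrNz; lra.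
(* The last arc is longer than [m - n t], hence covers [[n t, m]], while [u + i <= m]. *)
have un : u + i%:R < n%:R * t.
  by rewrite ltNge; apply/negP => nu; apply: (gap n (leqnn n)); lra.
have exl : exists j, u + i%:R < j%:R * t by exists n.
(* The gap ends at the first multiple of [t] above [u + i]; index 0 is excluded by [0 <= u + i]. *)
have [[|l] ul lmin] := ex_minnP exl.
  by move: ul; have := ler0n R i; lra.
have ln := lmin n un.
exists l => //; apply/andP; split=> //.
have lu : l%:R * t <= u + i%:R.
  by rewrite leNgt; apply/negP => /lmin; rewrite ltnn.
rewrite ltNge; apply/negP => ul'; apply: (gap l (ltnW ln)); lra.
Qed.

(** Finitely many strict inequalities leave room above [m - n t]; the induction treats the points
    one at a time, shrinking [L]. *)
Lemma gap_cert_length (R : realType) (n m : nat) (t u : R) :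
  unit_square (t, u) -> gap_cert n m t u ->
  exists L, m%:R - n%:R * t < L < 1 /\
    forall i, (i < m)%N -> exists2 l, (l < n)%N &
      l%:R * t + L < u + i%:R < l.+1%:R * t.
Proof.
move=> sq c; have [mlt _] := gap_cert_least sq c; case: c => _ _ gaps.
suff: forall k, (k <= m)%N -> exists L, m%:R - n%:R * t < L < 1 /\
    forall i, (i < k)%N -> exists2 l, (l < n)%N &
      l%:R * t + L < u + i%:R < l.+1%:R * t by exact.
elim=> [_|k IH km].
  exists ((m%:R - n%:R * t + 1) / 2); split=> //.
  by apply/andP; split; lra.
have [L [/andP[L0 L1] HL]] := IH (ltnW km).
have [l ln /andP[lu ul]] := gaps k km.
(* Shrinking [L] preserves the earlier gaps; the midpoint of [m - n t] and [u + k - l t] leaves the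
   new point beyond its arc. *)
pose L' := Num.min L ((m%:R - n%:R * t + (u + k%:R - l%:R * t)) / 2).
have L'L : L' <= L by rewrite /L' ge_min lexx.
have L'l : L' <= (m%:R - n%:R * t + (u + k%:R - l%:R * t)) / 2.
  by rewrite /L' ge_min lexx orbT.
have L'0 : m%:R - n%:R * t < L' by rewrite lt_min; apply/andP; split; lra.
exists L'; split=> [|i]; first by apply/andP; split; lra.
rewrite ltnS leq_eqVlt => /orP[/eqP ->|/HL[l' ln' ul']].
  by exists l => //; apply/andP; split; lra.
by exists l' => //; move: ul' => /andP[? ?]; apply/andP; split; lra.
Qed.

Lemma gap_cert_certifies (R : realType) (n m : nat) (t u : R) :
  unit_square (t, u) -> gap_cert n m t u ->
  exists I, certifies (fun _ : 'I_1 => rotation u) (rotation t) I n.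
Proof.
move=> sq c; have [n0 _ t0 /andP[u0 u1]] := gap_cert_bounds c.
have [L [/andP[L0 L1] gaps]] := gap_cert_length sq c.
case: c => m0 ntm _.
(* The arc [[- L, 0]] has right end 0, whose orbit lifts to [i t]; after [n] steps it lands at
   [n t - m], inside the arc. *)
have LI : - L < 0 < - L + 1 by apply/andP; split; lra.
exists (Arc LI); apply/certifies_rotationP; split=> //=; last first.
  by exists (- m%:Z); rewrite mulrNz; apply/andP; split; lra.
move=> i k le_in ik.
(* In terms of [j], meeting the enemy says that [u + j] lies in [[i t, i t + L]]. It is left of all
   these arcs for [j < 0], right of all for [j >= m], and in a gap otherwise. *)
have [j kE] : exists j : int, k = - j by exists (- k); rewrite opprK.
subst k; rewrite mulrNz in ik.
have it_nt : i%:R * t <= n%:R * t by rewrite ler_pM2r // ler_nat.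
have it0 : 0 <= i%:R * t by apply: mulr_ge0 => //; exact: ltW.
have [j_neg|j_nneg] := ltP j 0.
  have : (j%:~R : R) <= -1 by rewrite -(intrN R 1) ler_int; lia.
  by move: ik => /andP[_ ik]; lra.
have [m_le|j_lt] := leP m%:Z j.
  have : (m%:R : R) <= j%:~R by rewrite -[m%:R]/(m%:Z%:~R) ler_int.
  have [l _ /andP[lu _]] := gaps 0%N m0.
  have : 0 <= l%:R * t by apply: mulr_ge0 => //; exact: ltW.
  by move: ik => /andP[ik _]; lra.
have [j' jE] : exists j' : nat, j = j' by exists `|j|%N; lia.
subst j; have [l ln /andP[lu ul]] := gaps j' j_lt.
have [il|li] := leqP i l.
  have : i%:R * t <= l%:R * t by rewrite ler_pM2r // ler_nat.
  by move: ik => /andP[ik _]; lra.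
have : l.+1%:R * t <= i%:R * t by rewrite ler_pM2r // ler_nat.
by move: ik => /andP[_ ik]; lra.
Qed.

(** * The pieces of [U] and the final assembly *)

Lemma U_pieceP (R : realType) (m : nat) (t u : R) :
  U_piece m (t, u) <-> unit_square (t, u) /\ exists n, gap_cert n m t u.
Proof.
split=> [[/U_gap_certP[sq _] [n [[I win] ntm mmin]]]|[sq [n c]]].
  by split=> //; exists n; exact: certifies_gap_cert win ntm mmin.
split; first by apply/U_gap_certP; split=> //; exists n, m.
exists n; split; first exact: gap_cert_certifies c.
  by case: c.
by have [] := gap_cert_least sq c.
Qed.

(** Here [t <= n t < m], and [u + i < m] because [u < 1] and [i <= m - 1]. *)
Lemma unit_square_div (R : realType) (n m i : nat) (t u : R) : (i < m)%N ->
  gap_cert n m t u -> unit_square (t / m%:R, (u + i%:R) / m%:R).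
Proof.
move=> im c; have [n0 _ t0 /andP[u0 u1]] := gap_cert_bounds c.
case: c => m0 ntm _; have mR : 0 < m%:R :> R by rewrite ltr0n.
have iR : (i%:R : R) + 1 <= m%:R by rewrite natr1 ler_nat.
have i0 := ler0n R i.
have tnt : 1 * t <= n%:R * t by rewrite ler_pM2r // ler1n.
split=> /=; rewrite divr_ge0 ?ler_pdivrMr //=; lra.
Qed.

Theorem theorem4p16 (R : realType) :
  [/\ open (@U R) /\ @U R `<=` @unit_square R,
      forall t u : R, unit_square (t, u) ->
        (exists I, wins (fun _ : 'I_1 => rotation u) (rotation t) I)
        <-> @U R (t, u),
      @U_piece R 1 = @U1 R,
      forall (m : nat) (t u : R), (0 < m)%N -> unit_square (t, u) ->
        subdivided m t u -> @U R (t, u) &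
      forall (m : nat) (t u : R), U_piece m (t, u) -> subdivided m t u].
Proof.
split.
- by split; [exact: open_U|move=> p []].
- move=> t u sq; split=> [[I [n win]]|/U_gap_certP[_ [n [m c]]]].
    have nt0 : 0 <= n%:R * t by case: sq => /= /andP[? _] _; apply: mulr_ge0.
    (* The least integer above [n t] is its floor plus one. *)
    have [k kE] : exists k : nat, Num.floor (n%:R * t) = k.
      by exists `|Num.floor (n%:R * t)|%N; rewrite gez0_abs // floor_ge0.
    apply/U_gap_certP; split=> //; exists n, k.+1.
    apply: certifies_gap_cert win _ _ => //.
      have := lt_succ_floor (n%:R * t).
      by rewrite kE -[k.+1%:R]natr1 intrD.
    move=> m' ntm'; have : Num.floor (n%:R * t) < m' by rewrite floor_lt_int.
    by rewrite kE; lia.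
  have [I win] := gap_cert_certifies sq c.
  by exists I, n.
- apply/seteqP; split=> -[t u].
    by move=> /U_pieceP[_ [n c]]; apply/U1P; exists n.
  move=> /U1P[n c]; apply/U_pieceP; split; last by exists n.
  by have := unit_square_div (ltn0Sn 0) c; rewrite addr0 !divr1.
- move=> m t u m0 sq [k sub]; apply/U_gap_certP; split=> //.
  have /U_pieceP[_ [n c0]] := sub 0%N m0.
  (* The common [k] forces a common [n], so the certificates combine into one with integer [k m]. *)
  exists n, (k * m)%N; apply/gap_cert_divP => // i im.
  have /U_pieceP[_ [n' ci]] := sub i im.
  by rewrite (gap_cert_inj c0 ci).
(* Division by [m] itself brings all rescaled points into the piece of index 1. *)
- move=> m t u /U_pieceP[sq [n c]]; exists 1%N => i im; apply/U_pieceP.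
  split; first exact: unit_square_div c.
  have m0 : (0 < m)%N by case: c.
  exists n; move: i im; apply/gap_cert_divP => //; by rewrite mul1n.
Qed.
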